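(* Suppose that Assumption 1 (regularity) and Assumption 2 (Riccati condition), both stated in the context, hold for the two-player constrained linear-quadratic difference game described in the context. Consider the problem $$\mathrm{OCP\text{-}LCS}:\quad \min_{\mathbf x,\mathbf u^1,\boldsymbol\zeta,\boldsymbol\mu}\ \overline J_1(\mathbf x,\mathbf u^1,\boldsymbol\zeta,\boldsymbol\mu)$$ over $\mathbf x=\{x_k\in\mathbb R^n\}_{k\in\mathsf K}$, $\mathbf u^1=\{u_k^1\in\mathbb R^{m_1}\}_{k\in\mathsf K_l}$, $\boldsymbol\zeta=\{\zeta_k\in\mathbb R^n\}_{k\in\mathsf K}$, $\boldsymbol\mu=\{\mu_k\in\mathbb R^{c_2}\}_{k\in\mathsf K_l}$, subject to, for all $k\in\mathsf K_l$, $$x_{k+1}=\overline A_kx_k+\overline B_ku_k^1+\overline C_k\mu_k+\overline D_k\zeta_{k+1},$$ $$\zeta_k=\overline A_k^\top\zeta_{k+1}+\overline F_ku_k^1+\overline G_k\mu_k,$$ $$0\le\mu_k\perp E_k^2x_k+S_k^2u_k^1+W_k^2\zeta_{k+1}+U_k^2\mu_k+r_k^2\ge0,$$ $$E_k^1x_k+S_k^1u_k^1+W_k^1\zeta_{k+1}+U_k^1\mu_k+r_k^1\ge0,$$ with $x_0=\bar x_0$ and $\zeta_K=0$, where $$\overline J_1(\mathbf x,\mathbf u^1,\boldsymbol\zeta,\boldsymbol\mu)=\tfrac12\|x_K\|_{Q_K^1}^2+\tfrac12\sum_{k\in\mathsf K_l}\Big(\|x_k\|_{Q_k^1}^2+\|u_k^1\|_{R_k^{11}}^2+\big\|L_k^xx_k+L_k^uu_k^1+L_k^\zeta\zeta_{k+1}+L_k^\mu\mu_k\big\|_{R_k^{12}}^2\Big).$$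 Let $\mathsf S_{\mathrm{OCP\text{-}LCS}}$ denote the set of global minimizers of this problem, and let $\mathsf S_{\mathrm{GOLSE}}$ denote the set of generalized open-loop Stackelberg equilibria (GOLSEs) of the game. Then $$\mathsf S_{\mathrm{GOLSE}}=\Big\{\big(\mathbf u^1,\mathsf R(\mathbf x_l,\mathbf u^1,\boldsymbol\zeta_r,\boldsymbol\mu)\big)\ \Big|\ (\mathbf x,\mathbf u^1,\boldsymbol\zeta,\boldsymbol\mu)\in\mathsf S_{\mathrm{OCP\text{-}LCS}}\Big\},$$ where $\mathbf x_l=(x_k)_{k\in\mathsf K_l}$, $\boldsymbol\zeta_r=(\zeta_k)_{k\in\mathsf K_r}$, and $\mathsf R(\mathbf x_l,\mathbf u^1,\boldsymbol\zeta_r,\boldsymbol\mu):=\big(L_k^xx_k+L_k^uu_k^1+L_k^\zeta\zeta_{k+1}+L_k^\mu\mu_k\big)_{k\in\mathsf K_l}\in\mathbb R^{Km_2}$ (stacked as a column).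
   Context: Notation. $\mathbb S^n$ is the set of real symmetric $n\times n$ matrices; $\|x\|_A^2:=x^\top Ax$ for $A\in\mathbb S^n$ (not necessarily positive semidefinite). Vector inequalities are componentwise. $0\le x\perp y\ge0$ means $x\ge0$, $y\ge0$, $x^\top y=0$. Game. Player $1$ is the leader, player $2$ the follower. $K\ge1$ is an integer, $\mathsf K=\{0,1,\dots,K\}$, $\mathsf K_l=\{0,\dots,K-1\}$, $\mathsf K_r=\{1,\dots,K\}$. The dynamics are $$x_{k+1}=A_kx_k+B_k^1u_k^1+B_k^2u_k^2,\quad k\in\mathsf K_l,\qquad x_0=\bar x_0,$$ with $A_k\in\mathbb R^{n\times n}$, $B_k^i\in\mathbb R^{n\times m_i}$, $u_k^i\in\mathbb R^{m_i}$, and given $\bar x_0\in\mathbb R^n$. An open-loop strategy of player $i$ is $\mathbf u^i=(u_k^i)_{k\in\mathsf K_l}\in\mathbb R^{Km_i}$; $x_k(\mathbf u^1,\mathbf u^2)$ is the resulting state at time $k$. For $i\in\{1,2\}$, $k\in\mathsf K_l$, the constraints of player $i$ are $$g_k^i(x_k,u_k^1,u_k^2):=M_k^ix_k+N_k^{i1}u_k^1+N_k^{i2}u_k^2+r_k^i\ge0,$$ with $M_k^i\in\mathbb R^{c_i\times n}$, $N_k^{ij}\in\mathbb R^{c_i\times m_j}$, $r_k^i\in\mathbb R^{c_i}$. The cost minimized by player $i$ is $$J_i(\mathbf u^1,\mathbf u^2)=\tfrac12\|x_K\|_{Q_K^i}^2+\tfrac12\sum_{k\in\mathsf K_l}\big(\|x_k\|_{Q_k^i}^2+\|u_k^1\|_{R_k^{i1}}^2+\|u_k^2\|_{R_k^{i2}}^2\big),$$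 evaluated along the resulting state trajectory, with $Q_k^i\in\mathbb S^n$ ($k\in\mathsf K$), $R_k^{ij}\in\mathbb S^{m_j}$ ($k\in\mathsf K_l$). Feasible and reaction sets. $\Omega_2(\mathbf u^1):=\{\mathbf u^2\in\mathbb R^{Km_2}: g_k^2(x_k(\mathbf u^1,\mathbf u^2),u_k^1,u_k^2)\ge0\ \forall k\in\mathsf K_l\}$; $\mathsf U_1:=\{\mathbf u^1\in\mathbb R^{Km_1}:\Omega_2(\mathbf u^1)\ne\varnothing\}$; for $\mathbf u^1\in\mathsf U_1$, $\mathsf T(\mathbf u^1):=\arg\min_{\mathbf u^2\in\Omega_2(\mathbf u^1)}J_2(\mathbf u^1,\mathbf u^2)$ (when single-valued, identified with its unique element, whose stage-$k$ component is $\mathsf T_k(\mathbf u^1)$); $\Omega_1:=\{\mathbf u^1\in\mathsf U_1:\mathsf T(\mathbf u^1)\text{ is single-valued and } g_k^1(x_k(\mathbf u^1,\mathsf T(\mathbf u^1)),u_k^1,\mathsf T_k(\mathbf u^1))\ge0\ \forall k\in\mathsf K_l\}$. Equilibrium. $(\mathbf u^{1\star},\mathbf u^{2\star})$ is a generalized open-loop Stackelberg equilibrium (GOLSE) if (i) $\mathbf u^{1\star}\in\Omega_1$ and $\mathbf u^{2\star}=\mathsf T(\mathbf u^{1\star})$; (ii) $J_1(\mathbf u^{1\star},\mathsf T(\mathbf u^{1\star}))\le J_1(\mathbf u^1,\mathsf T(\mathbf u^1))$ for all $\mathbf u^1\in\Omega_1$. Assumption 1. (1) $\mathsf U_1\neq\varnothing$;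 (2) for each $\mathbf u^1\in\mathsf U_1$, $\Omega_2(\mathbf u^1)$ is bounded. Assumption 2. The solution of the Riccati difference equation $$P_k=Q_k^2+A_k^\top P_{k+1}A_k-V_k^\top\Gamma_k^{-1}V_k,\quad P_K=Q_K^2,\qquad \Gamma_k:=R_k^{22}+{B_k^2}^\top P_{k+1}B_k^2,\quad V_k:={B_k^2}^\top P_{k+1}A_k,$$ $k\in\mathsf K_l$, exists, and $\Gamma_k$ is positive definite for every $k\in\mathsf K_l$. Derived matrices ($k\in\mathsf K_l$). $L_k^x:=-\Gamma_k^{-1}V_k$, $L_k^u:=-\Gamma_k^{-1}{B_k^2}^\top P_{k+1}B_k^1$, $L_k^\zeta:=-\Gamma_k^{-1}{B_k^2}^\top$, $L_k^\mu:=\Gamma_k^{-1}{N_k^{22}}^\top$; $\overline A_k:=A_k+B_k^2L_k^x$, $\overline B_k:=B_k^1+B_k^2L_k^u$, $\overline C_k:=B_k^2L_k^\mu$, $\overline D_k:=B_k^2L_k^\zeta$, $\overline F_k:=A_k^\top P_{k+1}B_k^1+V_k^\top L_k^u$, $\overline G_k:=V_k^\top L_k^\mu-{M_k^2}^\top$; for $i\in\{1,2\}$: $E_k^i:=M_k^i+N_k^{i2}L_k^x$, $S_k^i:=N_k^{i1}+N_k^{i2}L_k^u$, $W_k^i:=N_k^{i2}L_k^\zeta$, $U_k^i:=N_k^{i2}L_k^\mu$. *)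

(* Defs.v *)
From HB Require Import structures.
From mathcomp Require Import all_boot all_order all_algebra.
From mathcomp Require Import all_classical all_reals all_analysis.

Set Implicit Arguments.
Unset Strict Implicit.
Unset Printing Implicit Defensive.

Import Order.TTheory GRing.Theory Num.Theory.
Import numFieldNormedType.Exports.

Local Open Scope classical_set_scope.
Local Open Scope ring_scope.

Variant player := leader | follower.

(* Data over [0, K-1] are indexed by 'I_K, data over [0, K] by 'I_K.+1; [tnow]
   and [tnext] send a stage k : 'I_K to the times k and k + 1 in 'I_K.+1. *)
Definition tnow {K : nat} (k : 'I_K) : 'I_K.+1 := widen_ord (leqnSn K) k.
Definition tnext {K : nat} (k : 'I_K) : 'I_K.+1 := lift ord0 k.

Section Vectors.
Context {R : realType}.

(* ||x||_A ^ 2; A need not be positive semidefinite. *)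
Definition sqnorm n (A : 'M[R]_n) (x : 'cV[R]_n) : R :=
  (x^T *m A *m x) ord0 ord0.

Definition posdefmx n (A : 'M[R]_n) : Prop :=
  A \is symmetricmx /\ forall x : 'cV[R]_n, x != 0 -> 0 < sqnorm A x.

Definition cvnneg n (x : 'cV[R]_n) : Prop := x \is a mxOver Num.nneg.

Definition complementary n (x y : 'cV[R]_n) : Prop :=
  [/\ cvnneg x, cvnneg y & x^T *m y = 0].

End Vectors.

(* Stacked column (u_k)_{k < K}, i.e. an element of R^(K * m). *)
Definition strategy (R : realType) (K m : nat) : Type :=
  'cV[R]_(\sum_(k < K) m).

Definition stage {R : realType} {K m : nat} (u : strategy R K m) (k : 'I_K) :
  'cV[R]_m := @submxcol R K (fun=> m) 1 u k.

(* [conN G i j] is the coefficient of player j's control in player i's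
   constraint, and [costR G i j] its weight in player i's cost. *)
Record game (R : realType) (K n : nat) (m c : player -> nat) := Game {
  dynA : 'I_K -> 'M[R]_n;
  dynB : forall i : player, 'I_K -> 'M[R]_(n, m i);
  xinit : 'cV[R]_n;
  conM : forall i : player, 'I_K -> 'M[R]_(c i, n);
  conN : forall i j : player, 'I_K -> 'M[R]_(c i, m j);
  conr : forall i : player, 'I_K -> 'cV[R]_(c i);
  costQ : player -> 'I_K.+1 -> 'M[R]_n;
  costR : player -> forall j : player, 'I_K -> 'M[R]_(m j);
  costQ_sym : forall i k, costQ i k \is symmetricmx;
  costR_sym : forall i j k, costR i j k \is symmetricmx
}.

Section Game.
Context {R : realType} {K n : nat} {m c : player -> nat}.
Variable G : game R K n m c.

Local Notation strat i := (strategy R K (m i)).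

Section Profile.
Variables (u1 : strat leader) (u2 : strat follower).

(* The value 0 is never reached at a time k <= K; see [state0], [stateS]. *)
Fixpoint state_at (k : nat) : 'cV[R]_n :=
  if k is l.+1 then
    if (insub l : option 'I_K) is Some i then
      dynA G i *m state_at l + dynB G leader i *m stage u1 i
        + dynB G follower i *m stage u2 i
    else 0
  else xinit G.

Definition state (k : 'I_K.+1) : 'cV[R]_n := state_at k.

Lemma state0 : state ord0 = xinit G.
Proof. by []. Qed.

Lemma stateS (k : 'I_K) :
  state (tnext k) = dynA G k *m state (tnow k) + dynB G leader k *m stage u1 k
                     + dynB G follower k *m stage u2 k.
Proof. by rewrite /state lift0 /= valK. Qed.

Definition constraint (i : player) (k : 'I_K) : 'cV[R]_(c i) :=
  conM G i k *m state (tnow k) + conN G i leader k *m stage u1 k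
    + conN G i follower k *m stage u2 k + conr G i k.

Definition cost (i : player) : R :=
  2^-1 * sqnorm (costQ G i ord_max) (state ord_max)
  + 2^-1 * \sum_(k < K) (sqnorm (costQ G i (tnow k)) (state (tnow k))
                         + sqnorm (costR G i leader k) (stage u1 k)
                         + sqnorm (costR G i follower k) (stage u2 k)).

End Profile.

Definition Omega2 (u1 : strat leader) : set (strat follower) :=
  [set u2 | forall k, cvnneg (constraint u1 u2 follower k)].

Definition U1 : set (strat leader) := [set u1 | Omega2 u1 !=set0].

Definition reaction (u1 : strat leader) : set (strat follower) :=
  [set u2 | Omega2 u1 u2 /\
            forall v2, Omega2 u1 v2 ->
              cost u1 u2 follower <= cost u1 v2 follower].

Definition Omega1 : set (strat leader) :=
  [set u1 | U1 u1 /\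
            exists u2, reaction u1 = [set u2] /\
                       forall k, cvnneg (constraint u1 u2 leader k)].

Definition GOLSE : set (strat leader * strat follower) :=
  [set u | [/\ Omega1 u.1, reaction u.1 = [set u.2] &
               forall v1 v2, Omega1 v1 -> reaction v1 = [set v2] ->
                 cost u.1 u.2 leader <= cost v1 v2 leader]].

Definition regularity : Prop :=
  U1 !=set0 /\ forall u1, U1 u1 -> bounded_set (Omega2 u1).

(* P is a candidate solution of the Riccati equation; the matrices below are
   relative to it. *)
Section Riccati.
Variable P : 'I_K.+1 -> 'M[R]_n.

Local Notation A := (dynA G).
Local Notation B := (dynB G).
Local Notation M := (conM G).
Local Notation N := (conN G).

Definition Gam (k : 'I_K) : 'M[R]_(m follower) :=
  costR G follower follower k + (B follower k)^T *m P (tnext k) *m B follower k.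

Definition Vmx (k : 'I_K) : 'M[R]_(m follower, n) :=
  (B follower k)^T *m P (tnext k) *m A k.

(* [invmx] is total, so the existence of the inverses is part of being a
   solution. *)
Definition riccati_solution : Prop :=
  P ord_max = costQ G follower ord_max /\
  forall k : 'I_K,
    Gam k \in unitmx /\
    P (tnow k) = costQ G follower (tnow k) + (A k)^T *m P (tnext k) *m A k
                  - (Vmx k)^T *m invmx (Gam k) *m Vmx k.

Definition riccati_condition : Prop :=
  riccati_solution /\ forall k, posdefmx (Gam k).

Definition Lx (k : 'I_K) : 'M[R]_(m follower, n) := - (invmx (Gam k) *m Vmx k).
Definition Lu (k : 'I_K) : 'M[R]_(m follower, m leader) :=
  - (invmx (Gam k) *m (B follower k)^T *m P (tnext k) *m B leader k).
Definition Lzeta (k : 'I_K) : 'M[R]_(m follower, n) :=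
  - (invmx (Gam k) *m (B follower k)^T).
Definition Lmu (k : 'I_K) : 'M[R]_(m follower, c follower) :=
  invmx (Gam k) *m (N follower follower k)^T.

Definition Abar (k : 'I_K) : 'M[R]_n := A k + B follower k *m Lx k.
Definition Bbar (k : 'I_K) : 'M[R]_(n, m leader) :=
  B leader k + B follower k *m Lu k.
Definition Cbar (k : 'I_K) : 'M[R]_(n, c follower) := B follower k *m Lmu k.
Definition Dbar (k : 'I_K) : 'M[R]_n := B follower k *m Lzeta k.
Definition Fbar (k : 'I_K) : 'M[R]_(n, m leader) :=
  (A k)^T *m P (tnext k) *m B leader k + (Vmx k)^T *m Lu k.
Definition Gbar (k : 'I_K) : 'M[R]_(n, c follower) :=
  (Vmx k)^T *m Lmu k - (M follower k)^T.

Definition Emx (i : player) (k : 'I_K) : 'M[R]_(c i, n) :=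
  M i k + N i follower k *m Lx k.
Definition Smx (i : player) (k : 'I_K) : 'M[R]_(c i, m leader) :=
  N i leader k + N i follower k *m Lu k.
Definition Wmx (i : player) (k : 'I_K) : 'M[R]_(c i, n) :=
  N i follower k *m Lzeta k.
Definition Umx (i : player) (k : 'I_K) : 'M[R]_(c i, c follower) :=
  N i follower k *m Lmu k.

Record lcs_point := LcsPoint {
  lcs_x : 'I_K.+1 -> 'cV[R]_n;
  lcs_u : strat leader;
  lcs_zeta : 'I_K.+1 -> 'cV[R]_n;
  lcs_mu : 'I_K -> 'cV[R]_(c follower)
}.

(* The arguments xl and zr are the families (x_k) for 0 <= k < K and
   (zeta_k) for 1 <= k <= K, the latter shifted so that zr k is zeta_{k+1}. *)
Definition Rstage (xl : 'I_K -> 'cV[R]_n) (u1 : strat leader)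
    (zr : 'I_K -> 'cV[R]_n) (mu : 'I_K -> 'cV[R]_(c follower)) (k : 'I_K) :
    'cV[R]_(m follower) :=
  Lx k *m xl k + Lu k *m stage u1 k + Lzeta k *m zr k + Lmu k *m mu k.

Definition Rmap xl u1 zr mu : strat follower :=
  \mxcol_(k < K) Rstage xl u1 zr mu k.

Definition lcs_response (z : lcs_point) : strat follower :=
  Rmap (lcs_x z \o tnow) (lcs_u z) (lcs_zeta z \o tnext) (lcs_mu z).

Definition lcs_constraint (z : lcs_point) (i : player) (k : 'I_K) :
    'cV[R]_(c i) :=
  Emx i k *m lcs_x z (tnow k) + Smx i k *m stage (lcs_u z) k
    + Wmx i k *m lcs_zeta z (tnext k) + Umx i k *m lcs_mu z k + conr G i k.

Definition lcs_feasible : set lcs_point :=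
  [set z |
    [/\ lcs_x z ord0 = xinit G,
        lcs_zeta z ord_max = 0 &
        forall k : 'I_K,
          [/\ lcs_x z (tnext k) =
                Abar k *m lcs_x z (tnow k) + Bbar k *m stage (lcs_u z) k
                  + Cbar k *m lcs_mu z k + Dbar k *m lcs_zeta z (tnext k),
              lcs_zeta z (tnow k) =
                (Abar k)^T *m lcs_zeta z (tnext k)
                  + Fbar k *m stage (lcs_u z) k + Gbar k *m lcs_mu z k,
              complementary (lcs_mu z k) (lcs_constraint z follower k) &
              cvnneg (lcs_constraint z leader k)]]].

Definition lcs_cost (z : lcs_point) : R :=
  2^-1 * sqnorm (costQ G leader ord_max) (lcs_x z ord_max)
  + 2^-1 * \sum_(k < K)
      (sqnorm (costQ G leader (tnow k)) (lcs_x z (tnow k))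
       + sqnorm (costR G leader leader k) (stage (lcs_u z) k)
       + sqnorm (costR G leader follower k)
           (Lx k *m lcs_x z (tnow k) + Lu k *m stage (lcs_u z) k
              + Lzeta k *m lcs_zeta z (tnext k) + Lmu k *m lcs_mu z k)).

Definition S_OCP_LCS : set lcs_point :=
  [set z | lcs_feasible z /\
           forall w, lcs_feasible w -> lcs_cost z <= lcs_cost w].

End Riccati.
End Game.

(* Main.v *)
From HB Require Import structures.
Require Import Defs.
From mathcomp Require Import all_boot all_order all_algebra.
From mathcomp Require Import all_classical all_reals all_analysis.
From mathcomp Require Import ring lra.
Import Order.TTheory GRing.Theory Num.Theory.
Import numFieldNormedType.Exports.
Set Implicit Arguments.
Unset Strict Implicit.
Unset Printing Implicit Defensive.
Local Open Scope classical_set_scope.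
Local Open Scope ring_scope.

(** Fix a strategy of the leader. The state is affine in the follower's strategy
and the follower's constraints are affine too, so the follower faces a quadratic
program with linear constraints. Such a program needs no constraint
qualification: an optimal strategy carries multipliers mu and a costate lambda
that satisfy the Karush-Kuhn-Tucker conditions ([reaction_kkt]). The only deep
ingredient is Farkas' lemma ([farkas]): moving slightly along a direction that
does not decrease any active constraint stays feasible, so the slope of the cost
is nonnegative on that cone, hence a nonnegative combination of the active
constraints. Summation by parts along the trajectory ([cost_slope_costate])
turns this equality of linear forms in the whole strategy into equalities at
each stage.

The converse rests on the Riccati equation. Completing squares, the quadratic
part of the follower's cost along a perturbation v with state response y is
one half of the sum over k of |v_k - L_k^x y_k|^2, measured by Gamma_k
([cost_curvature_riccati]). As Gamma_k is positive definite, this is nonnegative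
and vanishes only for v = 0, so a KKT strategy is the unique best reaction
([kkt_reaction]), even if the weights of the cost are indefinite.

Hence best reactions and KKT points are the same thing. Writing the costate as
lambda = P x + zeta, stationarity in the control becomes the feedback formula
for R(x, u, zeta, mu) ([control_gradient_feedback]) and the costate equation
becomes the recursion for zeta ([costate_step_feedback]): KKT points that also
satisfy the leader's constraints are the feasible points of the complementarity
system ([lcs_feasible_kkt], [kkt_lcs_point]). Both problems then minimize the
leader's cost over the same set of pairs of strategies. *)

(** * Farkas' lemma and small steps *)

(** Bartl's algebraic proof, by induction on the number of forms. If the form
[a j] is indispensable, some vector satisfies all other inequalities and makes
[b] negative; scale it to [e] with [a j e = 1]. Projecting along [e] onto the
kernel of [a j] eliminates [a j], whose multiplier is then read off at [e]. *)
Lemma farkas (F : realFieldType) (W : lmodType F) (I : eqType) (s : seq I)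
    (a : I -> {scalar W}) (b : {scalar W}) :
    uniq s ->
    (forall w, (forall i, i \in s -> 0 <= a i w) -> 0 <= b w) ->
  exists2 mu : I -> F,
    forall i, 0 <= mu i & forall w, b w = \sum_(i <- s) mu i * a i w.
Proof.
elim: s a b => [|j s IH] a b /=.
  move=> _ b_ge0; exists (fun=> 0) => // w; rewrite big_nil.
  have b_ge0' v : 0 <= b v by exact: b_ge0.
  by apply/eqP; rewrite eq_le b_ge0' andbT -oppr_ge0 -raddfN b_ge0'.
move=> /andP[js s_uniq] b_ge0.
have [b_s|] :=
  pselect (forall w, (forall i, i \in s -> 0 <= a i w) -> 0 <= b w).
  have [mu mu_ge0 bE] := IH a b s_uniq b_s.
  exists (fun i => if i == j then 0 else mu i) => [i|w]; first by case: ifP.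
  rewrite big_cons eqxx mul0r add0r bE !big_seq; apply: eq_bigr => i si.
  by case: eqP si js => // -> ->.
move=> /existsNP[e0 /not_implyP[e0_s /negP]]; rewrite -ltNge => be0.
have aje0 : a j e0 < 0.
  rewrite ltNge; apply: contraTN be0 => aj_ge0; rewrite -leNgt; apply: b_ge0.
  by move=> i; rewrite inE => /predU1P[->//|]; exact: e0_s.
pose e := (a j e0)^-1 *: e0.
have aje : a j e = 1 by rewrite linearZ /= mulVf// lt_eqF.
pose proj w := w - a j w *: e.
have projE (f : {scalar W}) w : f (proj w) = f w - a j w * f e.
  by rewrite raddfB /= linearZ.
have pr_lin (f : {scalar W}) : scalar (f \o proj).
  by move=> t u v; rewrite /= !projE !linearP /=; ring.
pose pr (f : {scalar W}) : {scalar W} :=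
  HB.pack (f \o proj) (GRing.isLinear.Build _ _ _ _ _ (pr_lin f)).
have [w pr_s|mu mu_ge0 bE] := IH (fun i => pr (a i)) (pr b) s_uniq.
  apply: (b_ge0 (proj w)) => i; rewrite inE => /predU1P[->|/pr_s//].
  by rewrite projE aje mulr1 subrr.
(* Forced by evaluating the claim at e, as [a j e = 1]. *)
pose muj := b e - \sum_(i <- s) mu i * a i e.
exists (fun i => if i == j then muj else mu i) => [i|w].
  case: eqP => // _; rewrite /muj subr_ge0; apply: (@le_trans _ _ 0).
    rewrite big_seq; apply: sumr_le0 => l /e0_s al; apply: mulr_ge0_le0 => //.
    by rewrite linearZ /= nmulr_rle0// invr_lt0.
  by rewrite linearZ /= nmulr_rge0 ?invr_lt0// ltW.
rewrite big_cons eqxx.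
have -> : b w = pr b w + a j w * b e by rewrite /= projE subrK.
rewrite bE [in RHS](eq_big_seq (fun i => mu i * a i w)); last first.
  by move=> i si; case: eqP si js => // -> ->.
have -> : \sum_(i <- s) mu i * pr (a i) w =
    \sum_(i <- s) mu i * a i w - a j w * \sum_(i <- s) mu i * a i e.
  by rewrite mulr_sumr -sumrB; apply: eq_bigr => i _; rewrite /= projE; ring.
by rewrite /muj; ring.
Qed.

Lemma near0_gt0 (R : realFieldType) (c a : R) : 0 < c ->
  \forall t \near 0^'+, 0 < c + t * a.
Proof.
move=> c0; have lim : c + t * a @[t --> 0^'+] --> c.
  rewrite (_ : nbhs c = nbhs (c + 0 * a)); last by rewrite mul0r addr0.
  by apply: cvgD; [exact: cvg_cst | apply: cvgMr_tmp; exact: cvg_within].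
exact: cvgr_gt lim _ c0.
Qed.

(** * Inner products and quadratic forms *)

Section Dot.
Context {R : realType}.

Definition dot n (x y : 'cV[R]_n) : R := (x^T *m y) ord0 ord0.

Lemma dotE n (x y : 'cV[R]_n) : dot x y = \sum_i x i ord0 * y i ord0.
Proof. by rewrite /dot mxE; apply: eq_bigr => i _; rewrite mxE. Qed.

Lemma dotC n (x y : 'cV[R]_n) : dot x y = dot y x.
Proof. by rewrite !dotE; apply: eq_bigr => i _; rewrite mulrC. Qed.

Lemma dot_is_scalar n (x : 'cV[R]_n) : scalar (dot x).
Proof. by move=> a y z; rewrite /dot linearP !mxE. Qed.

HB.instance Definition _ n (x : 'cV[R]_n) :=
  GRing.isLinear.Build R _ R _ (dot x) (dot_is_scalar x).

Lemma dotDl n (x y z : 'cV[R]_n) : dot (x + y) z = dot x z + dot y z.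
Proof. by rewrite ![dot _ z]dotC raddfD. Qed.

Lemma dotBl n (x y z : 'cV[R]_n) : dot (x - y) z = dot x z - dot y z.
Proof. by rewrite ![dot _ z]dotC raddfB. Qed.

Lemma dot_mulmxl n p (A : 'M[R]_(n, p)) x y : dot (A *m x) y = dot x (A^T *m y).
Proof. by rewrite /dot trmx_mul mulmxA. Qed.

Lemma dotvv_eq0 n (x : 'cV[R]_n) : dot x x = 0 -> x = 0.
Proof.
rewrite dotE => /psumr_eq0P x0; apply/colP => i; rewrite mxE; apply/eqP.
rewrite -sqrf_eq0 expr2; apply/eqP/x0 => // j _; rewrite -expr2; exact: sqr_ge0.
Qed.

Lemma dotvv_ge0 n (x : 'cV[R]_n) : 0 <= dot x x.
Proof. by rewrite dotE sumr_ge0// => i _; rewrite -expr2 sqr_ge0. Qed.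

Lemma sqnormE n (A : 'M[R]_n) x : sqnorm A x = dot x (A *m x).
Proof. by rewrite /sqnorm /dot mulmxA. Qed.

Lemma symmetricmx_tr n (A : 'M[R]_n) : A \is symmetricmx -> A^T = A.
Proof. by move=> /is_hermitianmxP; rewrite expr0 scale1r map_mx_id. Qed.

Lemma sqnormD n (A : 'M[R]_n) x y : A^T = A ->
  sqnorm A (x + y) = sqnorm A x + 2 * dot (A *m x) y + sqnorm A y.
Proof.
move=> At; rewrite !sqnormE mulmxDr !(dotDl, raddfD) /=.
rewrite [dot (A *m x) y]dot_mulmxl At (dotC y (A *m x)) dot_mulmxl At; ring.
Qed.

Lemma sqnormZ n (A : 'M[R]_n) t x : sqnorm A (t *: x) = t ^+ 2 * sqnorm A x.
Proof.
by rewrite !sqnormE dotC -scalemxAr !linearZ /= dotC linearZ /= dotC; ring.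
Qed.
End Dot.

Section Entrywise.
Context {V : zmodType} {p q : nat}.
Implicit Types X Y : 'M[V]_(p, q).

Lemma addmxE X Y i j : (X + Y) i j = X i j + Y i j.
Proof. by rewrite mxE. Qed.

Lemma oppmxE X i j : (- X) i j = - X i j.
Proof. by rewrite mxE. Qed.

(** Reduces identities between sums of matrices to [ring], without expanding the
matrix products that they contain. *)
Definition entrywiseE := (addmxE, oppmxE).

End Entrywise.

(** * Recursions over the horizon *)

Section Time.
Variable K : nat.

Lemma time_ind (Q : 'I_K.+1 -> Prop) :
  Q ord0 -> (forall k : 'I_K, Q (tnow k) -> Q (tnext k)) -> forall t, Q t.
Proof.
move=> Q0 QS [t]; elim: t => [|t IH] tK.
  by rewrite (_ : Ordinal tK = ord0)//; exact: val_inj.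
rewrite (_ : Ordinal tK = tnext (Ordinal (tK : t < K)%N)); last exact: val_inj.
apply: QS; rewrite (_ : tnow _ = Ordinal (ltnW tK))//; exact: val_inj.
Qed.

Lemma rev_ord_tnow (k : 'I_K) : rev_ord (tnow k) = tnext (rev_ord k).
Proof. by apply: val_inj; rewrite /= /bump /= add1n subSS subnSK. Qed.

Lemma rev_ord_tnext (k : 'I_K) : rev_ord (tnext k) = tnow (rev_ord k).
Proof. by rewrite -[RHS]rev_ordK rev_ord_tnow rev_ordK. Qed.

Lemma rev_ord_max : rev_ord (@ord_max K) = ord0.
Proof. by apply: val_inj; rewrite /= subnn. Qed.

Lemma time_ind_backward (Q : 'I_K.+1 -> Prop) :
  Q ord_max -> (forall k : 'I_K, Q (tnext k) -> Q (tnow k)) -> forall t, Q t.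
Proof.
move=> QK QS t; rewrite -[t]rev_ordK; move: (rev_ord t); apply: time_ind => [|k].
  by rewrite -rev_ord_max rev_ordK.
by rewrite rev_ord_tnow rev_ord_tnext => /QS.
Qed.

Lemma exists_trajectory_backward (T : Type) (zK : T) (f : 'I_K -> T -> T) :
  exists z : 'I_K.+1 -> T,
    z ord_max = zK /\ forall k, z (tnow k) = f k (z (tnext k)).
Proof.
(* Forward recursion in reversed time; its inner zK is a default that no time up
   to K reaches. *)
pose fix y (l : nat) : T := if l is l'.+1 then
  if (insub l' : option 'I_K) is Some i then f (rev_ord i) (y l') else zK else zK.
exists (fun t => y (rev_ord t)); split; first by rewrite rev_ord_max.
move=> k; rewrite rev_ord_tnow rev_ord_tnext.
by move: (rev_ord k) (rev_ordK k) => j <-; rewrite lift0 /= valK.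
Qed.

Lemma telescope_time (V : zmodType) (f : 'I_K.+1 -> V) :
  \sum_(k < K) (f (tnext k) - f (tnow k)) = f ord_max - f ord0.
Proof.
have E : f ord0 + \sum_(k < K) f (tnext k) = \sum_(k < K) f (tnow k) + f ord_max.
  by rewrite -big_ord_recl big_ord_recr.
rewrite sumrB; apply: (addrI (f ord0)).
by rewrite addrA E addrAC subrr add0r [RHS]addrC subrK.
Qed.

End Time.

Section Stages.
Context {R : realType} {K m : nat}.

Implicit Types u v : strategy R K m.

Lemma stageP a u v k : stage (a *: u + v) k = a *: stage u k + stage v k.
Proof. by apply/matrixP => i j; rewrite !mxE. Qed.

Lemma stageD u v k : stage (u + v) k = stage u k + stage v k.
Proof. by rewrite -[u in LHS]scale1r stageP scale1r. Qed.

Lemma stageZ a u k : stage (a *: u) k = a *: stage u k.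
Proof. by apply/matrixP => i j; rewrite !mxE. Qed.

Lemma stage_mxcol (f : 'I_K -> 'cV[R]_m) k :
  stage (\mxcol_(i < K) f i : strategy R K m) k = f k.
Proof. exact: mxcolK. Qed.

Lemma strategy_ext u v :
  (forall k, stage u k = stage v k) -> u = v.
Proof.
move=> uv; rewrite -[u]submxcolK -[v]submxcolK; apply: eq_mxcol => k.
exact: uv.
Qed.

End Stages.

(** * Expansion of the follower's cost *)

Section Variation.
Context {R : realType} {K n : nat} {m c : player -> nat}.
Variable G : game R K n m c.

Local Notation strat i := (strategy R K (m i)).
Local Notation A := (dynA G).
Local Notation B := (dynB G).
Local Notation M := (conM G follower).
Local Notation N := (conN G follower follower).
Local Notation Q := (costQ G follower).
Local Notation Rf := (costR G follower follower).

(** The derivative of the state along [v]; it does not depend on the base point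
since the dynamics are affine. *)
Fixpoint sensitivity_at (v : strat follower) (k : nat) : 'cV[R]_n :=
  if k is l.+1 then
    if (insub l : option 'I_K) is Some i then
      A i *m sensitivity_at v l + B follower i *m stage v i
    else 0
  else 0.

Definition sensitivity v (k : 'I_K.+1) : 'cV[R]_n := sensitivity_at v k.

Lemma sensitivity0 v : sensitivity v ord0 = 0. Proof. by []. Qed.

Lemma sensitivityS v (k : 'I_K) : sensitivity v (tnext k) =
  A k *m sensitivity v (tnow k) + B follower k *m stage v k.
Proof. by rewrite /sensitivity lift0 /= valK. Qed.

Lemma sensitivityP a v w t :
  sensitivity (a *: v + w) t = a *: sensitivity v t + sensitivity w t.
Proof.
elim/time_ind: t => [|k IH]; first by rewrite !sensitivity0 scaler0 addr0.
by rewrite !sensitivityS IH stageP !linearP /= scalerDr addrACA.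
Qed.

Lemma sensitivityZ a v t : sensitivity (a *: v) t = a *: sensitivity v t.
Proof.
elim/time_ind: t => [|k IH]; first by rewrite !sensitivity0 scaler0.
by rewrite !sensitivityS IH stageZ scalerDr -!scalemxAr.
Qed.

Lemma stateD u1 u2 v t :
  state G u1 (u2 + v) t = state G u1 u2 t + sensitivity v t.
Proof.
elim/time_ind: t => [|k IH]; first by rewrite !state0 sensitivity0 addr0.
rewrite !stateS sensitivityS IH stageD !mulmxDr.
rewrite -!addrA; congr (_ + _); rewrite addrCA; congr (_ + _).
by rewrite addrCA.
Qed.

Definition constraint_variation v (k : 'I_K) : 'cV[R]_(c follower) :=
  M k *m sensitivity v (tnow k) + N k *m stage v k.

Lemma constraint_variationP a v w k : constraint_variation (a *: v + w) k =
  a *: constraint_variation v k + constraint_variation w k.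
Proof.
by rewrite /constraint_variation sensitivityP stageP !linearP /= scalerDr addrACA.
Qed.

Lemma constraint_variationZ a v k :
  constraint_variation (a *: v) k = a *: constraint_variation v k.
Proof.
by rewrite /constraint_variation sensitivityZ stageZ scalerDr -!scalemxAr.
Qed.

Lemma constraintD u1 u2 v k : constraint G u1 (u2 + v) follower k =
  constraint G u1 u2 follower k + constraint_variation v k.
Proof.
rewrite /constraint stateD stageD !mulmxDr.
rewrite /constraint_variation [RHS]addrAC; congr (_ + _).
rewrite -!addrA; congr (_ + _); rewrite addrCA; congr (_ + _).
by rewrite addrCA.
Qed.

Definition cost_slope u1 u2 v : R :=
  dot (Q ord_max *m state G u1 u2 ord_max) (sensitivity v ord_max)
  + \sum_(k < K)
      (dot (Q (tnow k) *m state G u1 u2 (tnow k)) (sensitivity v (tnow k))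
       + dot (Rf k *m stage u2 k) (stage v k)).

Lemma cost_slope_is_scalar u1 u2 : scalar (cost_slope u1 u2).
Proof.
move=> a u v; rewrite /cost_slope.
rewrite sensitivityP linearP /= mulrDr -!addrA; congr (_ + _).
rewrite addrCA; congr (_ + _); rewrite mulr_sumr -big_split; apply: eq_bigr => k _.
by rewrite sensitivityP stageP !linearP /=; ring.
Qed.

HB.instance Definition _ u1 u2 :=
  GRing.isLinear.Build R _ R _ (cost_slope u1 u2) (cost_slope_is_scalar u1 u2).

Definition cost_curvature v : R :=
  2^-1 * (sqnorm (Q ord_max) (sensitivity v ord_max)
    + \sum_(k < K) (sqnorm (Q (tnow k)) (sensitivity v (tnow k))
                    + sqnorm (Rf k) (stage v k))).

Lemma cost_curvatureZ a v : cost_curvature (a *: v) = a ^+ 2 * cost_curvature v.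
Proof.
rewrite /cost_curvature sensitivityZ sqnormZ.
rewrite [RHS]mulrCA; congr (_ * _); rewrite mulrDr mulr_sumr; congr (_ + _).
apply: eq_bigr => k _.
by rewrite sensitivityZ stageZ !sqnormZ mulrDr.
Qed.

Lemma cost_variation u1 u2 v : cost G u1 (u2 + v) follower =
  cost G u1 u2 follower + cost_slope u1 u2 v + cost_curvature v.
Proof.
rewrite /cost /cost_slope /cost_curvature -!mulrDr.
rewrite stateD sqnormD ?symmetricmx_tr ?costQ_sym//.
pose S1 := \sum_(k < K) (sqnorm (Q (tnow k)) (state G u1 u2 (tnow k))
                         + sqnorm (costR G follower leader k) (stage u1 k)
                         + sqnorm (Rf k) (stage u2 k)).
under eq_bigr => k _.
  rewrite stateD stageD.
  rewrite !sqnormD ?symmetricmx_tr ?costQ_sym ?costR_sym//.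
  over.
set a1 := sqnorm _ _; set a2 := dot _ _; set a3 := sqnorm _ _.
pose S2 := \sum_(k < K)
  (dot (Q (tnow k) *m state G u1 u2 (tnow k)) (sensitivity v (tnow k))
   + dot (Rf k *m stage u2 k) (stage v k)).
pose S3 := \sum_(k < K) (sqnorm (Q (tnow k)) (sensitivity v (tnow k))
                         + sqnorm (Rf k) (stage v k)).
rewrite (_ : \sum_(k < K) _ = S1 + 2 * S2 + S3); last first.
  by rewrite mulr_sumr -!big_split; apply: eq_bigr => k _ /=; ring.
by rewrite -/S1 -/S2 -/S3; field.
Qed.

End Variation.

(** * Optimality conditions of the follower *)

Section KKT.
Context {R : realType} {K n : nat} {m c : player -> nat}.
Variable G : game R K n m c.

Local Notation strat i := (strategy R K (m i)).
Local Notation A := (dynA G).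
Local Notation B := (dynB G).
Local Notation M := (conM G follower).
Local Notation N := (conN G follower follower).
Local Notation Q := (costQ G follower).
Local Notation Rf := (costR G follower follower).

Implicit Types (v w : strat follower).
Implicit Types (mu : 'I_K -> 'cV[R]_(c follower)) (lam : 'I_K.+1 -> 'cV[R]_n).

Definition is_costate (u1 : strat leader) (u2 : strat follower) mu lam : Prop :=
  lam ord_max = Q ord_max *m state G u1 u2 ord_max /\
  forall k, lam (tnow k) = Q (tnow k) *m state G u1 u2 (tnow k)
                           + (A k)^T *m lam (tnext k) - (M k)^T *m mu k.

Definition control_gradient (u2 : strat follower) mu lam (k : 'I_K) :
    'cV[R]_(m follower) :=
  Rf k *m stage u2 k + (B follower k)^T *m lam (tnext k) - (N k)^T *m mu k.

Definition kkt u1 u2 mu lam : Prop :=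
  [/\ is_costate u1 u2 mu lam,
      forall k, control_gradient u2 mu lam k = 0 &
      forall k, complementary (mu k) (constraint G u1 u2 follower k)].

(** The adjoint identity: the costate telescopes against the sensitivity, whose
initial value is 0, and only local terms in [stage v k] survive besides the
constraint terms. *)
Lemma cost_slope_costate u1 u2 mu lam v : is_costate u1 u2 mu lam ->
  cost_slope G u1 u2 v =
    \sum_(k < K) (dot (control_gradient u2 mu lam k) (stage v k)
                  + dot (mu k) (constraint_variation G v k)).
Proof.
move=> [lamK lamS]; rewrite /cost_slope -lamK.
have -> : dot (lam ord_max) (sensitivity G v ord_max) =
    \sum_(k < K) (dot (lam (tnext k)) (sensitivity G v (tnext k))
                  - dot (lam (tnow k)) (sensitivity G v (tnow k))).
  rewrite (telescope_time (fun t => dot (lam t) (sensitivity G v t))).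
  by rewrite sensitivity0 raddf0 subr0.
rewrite -big_split; apply: eq_bigr => k _ /=.
rewrite sensitivityS lamS /control_gradient /constraint_variation.
by rewrite !(dotBl, dotDl, raddfD) /= !dot_mulmxl !trmxK; ring.
Qed.

(** Optimality along rays makes the slope of the cost nonnegative on the cone of
directions that decrease no active constraint; Farkas' lemma then supplies the
multipliers, extended by 0 to the inactive constraints. *)
Lemma reaction_kkt u1 u2 : reaction G u1 u2 ->
  exists mu lam, kkt u1 u2 mu lam.
Proof.
move=> [u2_feas u2_min].
pose con (i : 'I_K * 'I_(c follower)) :=
  constraint G u1 u2 follower i.1 i.2 ord0.
have con_ge0 i : 0 <= con i by have /mxOverP/(_ i.2 ord0) := u2_feas i.1.
have var_scalar i : scalar (fun v => constraint_variation G v i.1 i.2 ord0).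
  by move=> a v w; rewrite constraint_variationP !mxE.
pose var i : {scalar strat follower} :=
  HB.pack (fun v => constraint_variation G v i.1 i.2 ord0)
          (GRing.isLinear.Build _ _ _ _ _ (var_scalar i)).
pose active := [pred i | con i == 0].
have [v var_ge0|nu nu_ge0 slopeE] :=
    @farkas _ _ _ (enum active) var (cost_slope G u1 u2) (enum_uniq _).
  (* Otherwise a small step along v is feasible and lowers the cost. *)
  rewrite leNgt; apply/negP => slope_lt0.
  have feas_near : \forall t \near 0^'+, Omega2 G u1 (u2 + t *: v).
    have con_near i : \forall t \near 0^'+, 0 <= con i + t * var i v.
      have := con_ge0 i; rewrite le_eqVlt => /predU1P[con0|/near0_gt0 con_gt0].
        near=> t; rewrite -con0 add0r mulr_ge0// var_ge0//.
        by rewrite mem_enum inE -con0.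
      by near=> t; apply: ltW; near: t; exact: con_gt0.
    have all_con_near := filter_forall _ con_near.
    near=> t; have con_t : forall i, 0 <= con i + t * var i v.
      by near: t; exact: all_con_near.
    move=> k; apply/mxOverP => i j; rewrite ord1 nnegrE constraintD.
    rewrite constraint_variationZ [X in _ <= X]mxE [X in _ + X]mxE.
    exact: con_t (k, i).
  have decrease_near : \forall t \near 0^'+,
      0 < - cost_slope G u1 u2 v + t * - cost_curvature G v.
    by apply: near0_gt0; rewrite oppr_gt0.
  near (0 : R)^'+ => t; have t_gt0 : 0 < t by [].
  have t_feas : Omega2 G u1 (u2 + t *: v) by near: t.
  have := u2_min _ t_feas; rewrite cost_variation linearZ /= cost_curvatureZ.
  have : 0 < - cost_slope G u1 u2 v + t * - cost_curvature G v by near: t.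
  by move=> /(mulr_gt0 t_gt0); lra.
pose mu k : 'cV[R]_(c follower) :=
  \col_j (if (k, j) \in active then nu (k, j) else 0).
have slope_mu v : cost_slope G u1 u2 v =
    \sum_(k < K) dot (mu k) (constraint_variation G v k).
  rewrite slopeE big_enum big_mkcond /=.
  transitivity (\sum_k \sum_j
      if (k, j) \in active then nu (k, j) * var (k, j) v else 0).
    by rewrite pair_bigA; apply: eq_bigr => -[].
  apply: eq_bigr => k _; rewrite dotE; apply: eq_bigr => j _; rewrite mxE inE.
  by case: ifP; rewrite ?mul0r.
have [lam lam_costate] := exists_trajectory_backward
  (Q ord_max *m state G u1 u2 ord_max)
  (fun k l => Q (tnow k) *m state G u1 u2 (tnow k) + (A k)^T *m l
              - (M k)^T *m mu k).
exists mu, lam; split=> // k.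
  (* Test the slope against the stacked control gradient itself. *)
  pose v : strat follower := \mxcol_(k < K) control_gradient u2 mu lam k.
  have := cost_slope_costate v lam_costate; rewrite slope_mu big_split /=.
  move/esym/(canRL (addrK _)); rewrite subrr => /psumr_eq0P grad0.
  apply: dotvv_eq0.
  rewrite -{2}[control_gradient _ _ _ k](stage_mxcol (control_gradient u2 mu lam)).
  by apply: grad0 => // i _; rewrite stage_mxcol dotvv_ge0.
split; [|exact: u2_feas|].
  by apply/mxOverP => i j; rewrite mxE nnegrE; case: ifP.
apply/matrixP => i j; rewrite !ord1 [RHS]mxE -[LHS]/(dot _ _) dotE big1// => l _.
rewrite mxE inE; case: eqP => [/= con0|_]; last by rewrite mul0r.
by rewrite -[X in _ * X]/(con (k, l)) con0 mulr0.
Unshelve. all: by end_near.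
Qed.

(** * Sufficiency from the Riccati equation *)

Section Riccati.
Variable P : 'I_K.+1 -> 'M[R]_n.
Hypothesis riccati : riccati_condition G P.

Lemma Gam_unit k : Gam G P k \in unitmx.
Proof. by have [[_ /(_ k)[]]] := riccati. Qed.

Lemma Gam_sym k : (Gam G P k)^T = Gam G P k.
Proof. by have [_ /(_ k)[/symmetricmx_tr]] := riccati. Qed.

Lemma sqnorm_Gam_ge0 k x : 0 <= sqnorm (Gam G P k) x.
Proof.
have [->|x0] := eqVneq x 0; first by rewrite sqnormE mulmx0 raddf0.
by have [_ /(_ k)[_ /(_ x x0)/ltW]] := riccati.
Qed.

Lemma riccati_sym t : (P t)^T = P t.
Proof.
have [[PK PS] _] := riccati.
elim/time_ind_backward: t => [|k IH].
  by rewrite PK symmetricmx_tr// costQ_sym.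
have [_ ->] := PS k; rewrite !(linearB, linearD) /= !trmx_mul trmx_inv !trmxK.
by rewrite Gam_sym IH symmetricmx_tr ?costQ_sym// !mulmxA.
Qed.

(** The terminal weight is the terminal value of P, so it telescopes into the
increments of the quadratic form of P along the sensitivity; at each stage the
Riccati equation says exactly that what remains is a perfect square. *)
Lemma cost_curvature_riccati v : cost_curvature G v =
  2^-1 * \sum_(k < K)
    sqnorm (Gam G P k) (stage v k - Lx G P k *m sensitivity G v (tnow k)).
Proof.
have [[PK PS] _] := riccati; rewrite /cost_curvature -PK; congr (_ * _).
have -> : sqnorm (P ord_max) (sensitivity G v ord_max) =
    \sum_(k < K) (sqnorm (P (tnext k)) (sensitivity G v (tnext k))
                  - sqnorm (P (tnow k)) (sensitivity G v (tnow k))).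
  rewrite (telescope_time (fun t => sqnorm (P t) (sensitivity G v t))).
  by rewrite sensitivity0 [X in _ - X]sqnormE mulmx0 raddf0 subr0.
rewrite -big_split; apply: eq_bigr => k _ /=; rewrite sensitivityS.
have [_ ->] := PS k.
have GK : Gam G P k *m invmx (Gam G P k) = 1%:M by rewrite mulmxV// Gam_unit.
rewrite /Lx mulNmx opprK !sqnormD ?riccati_sym ?Gam_sym//.
set y := sensitivity _ _ _; set e := _ *m _ *m y; set p := A k *m y.
set b := _ *m stage v k.
have Ge : Gam G P k *m e = Vmx G P k *m y by rewrite /e !mulmxA GK mul1mx.
have Vy : Vmx G P k *m y = (B follower k)^T *m (P (tnext k) *m p).
  by rewrite /Vmx /p !mulmxA.
have e_Vy : dot (Vmx G P k *m y) e = dot e (Gam G P k *m e) by rewrite Ge dotC.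
have v_Ge : dot (Gam G P k *m stage v k) e = dot b (P (tnext k) *m p).
  by rewrite dot_mulmxl Gam_sym Ge Vy -dot_mulmxl.
have v_Gv : sqnorm (Gam G P k) (stage v k) =
    sqnorm (Rf k) (stage v k) + sqnorm (P (tnext k)) b.
  by rewrite !sqnormE /Gam mulmxDl raddfD /= -!mulmxA dot_mulmxl.
have y_Py : sqnorm (Q (tnow k) + (A k)^T *m P (tnext k) *m A k
      - (Vmx G P k)^T *m invmx (Gam G P k) *m Vmx G P k) y =
    sqnorm (Q (tnow k)) y + sqnorm (P (tnext k)) p - sqnorm (Gam G P k) e.
  rewrite !sqnormE -e_Vy mulmxBl mulmxDl raddfB raddfD /= -!mulmxA -!dot_mulmxl.
  by rewrite /e -!mulmxA.
rewrite v_Ge v_Gv y_Py (dotC _ b); ring.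
Qed.

Lemma cost_curvature_ge0 v : 0 <= cost_curvature G v.
Proof.
rewrite cost_curvature_riccati mulr_ge0 ?invr_ge0//; apply: sumr_ge0 => k _.
exact: sqnorm_Gam_ge0.
Qed.

(** If all the squares vanish, then [v] is a linear feedback of its own response,
which starts at 0, so both stay 0. *)
Lemma cost_curvature_eq0 v : cost_curvature G v = 0 -> v = 0.
Proof.
rewrite cost_curvature_riccati => /eqP; rewrite mulf_eq0 invr_eq0 pnatr_eq0 /=.
move=> /eqP/psumr_eq0P curv0.
have stageE k : stage v k = Lx G P k *m sensitivity G v (tnow k).
  apply/eqP; rewrite -subr_eq0; apply/negP => /negP ne0.
  have [_ /(_ k)[_ /(_ _ ne0)]] := riccati.
  by rewrite curv0 ?ltxx// => i _; exact: sqnorm_Gam_ge0.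
have sens0 t : sensitivity G v t = 0.
  elim/time_ind: t => [|k IH]; first exact: sensitivity0.
  by rewrite sensitivityS stageE IH !mulmx0 addr0.
apply: strategy_ext => k; rewrite stageE sens0 mulmx0.
by rewrite -(scale0r v) stageZ scale0r.
Qed.

(** By the adjoint identity and complementarity, a competitor [w] costs more by
the multipliers paired with its constraint values, plus the curvature of
[w - u2]; strict positivity of the latter gives uniqueness. *)
Lemma kkt_reaction u1 u2 mu lam : kkt u1 u2 mu lam -> reaction G u1 = [set u2].
Proof.
move=> [costate grad0 compl].
have cost_gap w : Omega2 G u1 w ->
    cost G u1 u2 follower + cost_curvature G (w - u2) <= cost G u1 w follower.
  move=> w_feas; rewrite -{2}(subrK u2 w) [w - u2 + u2]addrC cost_variation.
  rewrite lerD2r lerDl (cost_slope_costate _ costate); apply: sumr_ge0 => k _.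
  rewrite grad0 dotC raddf0 add0r.
  have [mu_ge0 _ mu_con] := compl k.
  have -> : constraint_variation G (w - u2) k =
      constraint G u1 w follower k - constraint G u1 u2 follower k.
    rewrite -{2}(subrK u2 w) [w - u2 + u2]addrC constraintD.
    by rewrite [RHS]addrAC subrr add0r.
  rewrite raddfB /= [X in _ - X](_ : _ = 0) ?subr0; last first.
    by rewrite /dot mu_con mxE.
  rewrite dotE; apply: sumr_ge0 => j _; apply: mulr_ge0.
    by have /mxOverP/(_ j ord0) := mu_ge0.
  by have /mxOverP/(_ j ord0) := w_feas k.
have u2_react : reaction G u1 u2.
  split=> [k|w w_feas]; first by have [] := compl k.
  by apply: le_trans (cost_gap w w_feas); rewrite lerDl cost_curvature_ge0.
apply/seteqP; split=> [w [w_feas w_min]|_ ->//]; apply/eqP.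
rewrite -subr_eq0; apply/eqP/cost_curvature_eq0/le_anti.
rewrite cost_curvature_ge0 andbT.
by have := le_trans (cost_gap w w_feas) (w_min _ (proj1 u2_react)); rewrite gerDl.
Qed.

(** * Optimality conditions as a complementarity system *)

Implicit Types (x z : 'cV[R]_n) (uk : 'cV[R]_(m leader)).

Local Notation feedback k x uk z mu :=
  (Lx G P k *m x + Lu G P k *m uk + Lzeta G P k *m z + Lmu G P k *m mu).

Lemma closed_loop_dynamics k x uk z muk :
  A k *m x + B leader k *m uk + B follower k *m feedback k x uk z muk =
  Abar G P k *m x + Bbar G P k *m uk + Cbar G P k *m muk + Dbar G P k *m z.
Proof.
rewrite /Abar /Bbar /Cbar /Dbar !mulmxDl !mulmxDr !mulmxA.
by apply/matrixP => i j; rewrite !entrywiseE; ring.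
Qed.

Lemma closed_loop_constraint i k x uk z muk :
  conM G i k *m x + conN G i leader k *m uk
    + conN G i follower k *m feedback k x uk z muk + conr G i k =
  Emx G P i k *m x + Smx G P i k *m uk + Wmx G P i k *m z + Umx G P i k *m muk
    + conr G i k.
Proof.
rewrite /Emx /Smx /Wmx /Umx !mulmxDl !mulmxDr !mulmxA.
by apply/matrixP => r j; rewrite !entrywiseE; ring.
Qed.

(** With the costate [P x + z] the control gradient is affine in the control [w]
with invertible linear part Gamma, hence vanishes only at the feedback value. *)
Lemma control_gradient_feedback k x uk (w : 'cV[R]_(m follower)) z muk :
  Rf k *m w + (B follower k)^T
      *m (P (tnext k) *m (A k *m x + B leader k *m uk + B follower k *m w) + z)
    - (N k)^T *m muk
  = Gam G P k *m (w - feedback k x uk z muk).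
Proof.
have GK p (X : 'M[R]_(m follower, p)) : Gam G P k *m (invmx (Gam G P k) *m X) = X.
  by rewrite mulmxA mulmxV ?mul1mx// Gam_unit.
rewrite mulmxBr /Lx /Lu /Lzeta /Lmu !mulNmx -!mulmxA !(mulmxDr (Gam G P k)).
rewrite !mulmxN !GK /Gam /Vmx !mulmxDl !mulmxDr !mulmxA.
by apply/matrixP => i j; rewrite !entrywiseE; ring.
Qed.

(** The Riccati equation cancels every term in [x], so that zeta obeys a recursion
in which the state no longer appears. *)
Lemma costate_step_feedback k x uk z muk :
  Q (tnow k) *m x + (A k)^T *m (P (tnext k) *m (A k *m x + B leader k *m uk
      + B follower k *m feedback k x uk z muk) + z) - (M k)^T *m muk
    - P (tnow k) *m x
  = (Abar G P k)^T *m z + Fbar G P k *m uk + Gbar G P k *m muk.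
Proof.
have [[_ /(_ k)[_ ->]] _] := riccati.
have VE : (Vmx G P k)^T = (A k)^T *m P (tnext k) *m B follower k.
  by rewrite /Vmx !trmx_mul trmxK riccati_sym mulmxA.
have AbarE : (Abar G P k)^T = (A k)^T + (Vmx G P k)^T *m Lzeta G P k.
  rewrite /Abar /Lx /Lzeta linearD /= trmx_mul linearN /= trmx_mul trmx_inv.
  by rewrite Gam_sym mulNmx mulmxN !mulmxA.
rewrite AbarE /Fbar /Gbar !mulmxDr !mulmxBl !mulmxDl !mulmxA -VE.
rewrite {1}/Lx mulmxN mulmxA !mulNmx.
have <- : (Vmx G P k)^T *m invmx (Gam G P k) *m Vmx G P k *m x =
    (Vmx G P k)^T *m invmx (Gam G P k) *m (B follower k)^T *m P (tnext k)
      *m A k *m x.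
  by rewrite /Vmx !mulmxA.
by apply/matrixP => i j; rewrite !entrywiseE; ring.
Qed.

Lemma stage_response y k : stage (lcs_response G P y) k =
  feedback k (lcs_x y (tnow k)) (stage (lcs_u y) k)
           (lcs_zeta y (tnext k)) (lcs_mu y k).
Proof. by rewrite /lcs_response /Rmap stage_mxcol. Qed.

Section SharedTrajectory.
Variable y : @lcs_point R K n m c.
Local Notation u := (lcs_u y).
Local Notation w := (lcs_response G P y).
Hypothesis xE : forall t, lcs_x y t = state G u w t.

Lemma lcs_constraintE i k : lcs_constraint G P y i k = constraint G u w i k.
Proof. by rewrite /constraint -xE stage_response closed_loop_constraint. Qed.

Lemma lcs_costE : lcs_cost G P y = cost G u w leader.
Proof.
rewrite /lcs_cost /cost -xE; congr (_ + _ * _); apply: eq_bigr => k _.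
by rewrite -xE stage_response.
Qed.

End SharedTrajectory.

Lemma lcs_feasible_state y : lcs_feasible G P y ->
  forall t, lcs_x y t = state G (lcs_u y) (lcs_response G P y) t.
Proof.
move=> [x0 _ step]; elim/time_ind => [|k IH]; first by rewrite x0 state0.
have [-> _ _ _] := step k.
by rewrite stateS -IH stage_response closed_loop_dynamics.
Qed.

Lemma lcs_feasible_kkt y : lcs_feasible G P y ->
  kkt (lcs_u y) (lcs_response G P y) (lcs_mu y)
      (fun t => P t *m lcs_x y t + lcs_zeta y t).
Proof.
move=> y_feas; have xE := lcs_feasible_state y_feas.
have [_ zetaK step] := y_feas; have [[PK _] _] := riccati.
have dyn k : lcs_x y (tnext k) = A k *m lcs_x y (tnow k)
    + B leader k *m stage (lcs_u y) k
    + B follower k *m stage (lcs_response G P y) k by rewrite !xE stateS.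
split=> [|k|k]; first split=> [|k].
- by rewrite zetaK addr0 PK xE.
- have [_ -> _ _] := step k.
  rewrite -(costate_step_feedback _ (lcs_x y (tnow k))) -xE dyn stage_response.
  by rewrite addrC subrK.
- rewrite /control_gradient dyn control_gradient_feedback.
  by rewrite stage_response subrr mulmx0.
- by have [_ _ + _] := step k; rewrite lcs_constraintE.
Qed.

Lemma kkt_lcs_point u1 u2 mu lam : kkt u1 u2 mu lam ->
    (forall k, cvnneg (constraint G u1 u2 leader k)) ->
  exists y : @lcs_point R K n m c,
    [/\ lcs_feasible G P y, lcs_u y = u1 & lcs_response G P y = u2].
Proof.
move=> [[lamK lamS] grad0 compl] con_ge0; have [[PK _] _] := riccati.
pose y := @LcsPoint R K n m c (state G u1 u2) u1
  (fun t => lam t - P t *m state G u1 u2 t) mu.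
have stage_u2 k : stage u2 k = stage (lcs_response G P y) k.
  rewrite stage_response; apply/eqP; rewrite -subr_eq0.
  rewrite -(mul1mx (_ - _)) -(mulVmx (Gam_unit k)) -mulmxA.
  rewrite -(control_gradient_feedback k (state G u1 u2 (tnow k))) -stateS /=.
  rewrite addrC.
  by rewrite [P _ *m _ + _]addrC subrK addrC [_ + _ - _]grad0 mulmx0.
have u2E : lcs_response G P y = u2 by apply: strategy_ext => k; rewrite stage_u2.
exists y; split=> //; split=> [//||k]; first by rewrite /= lamK PK subrr.
have xE t : lcs_x y t = state G (lcs_u y) (lcs_response G P y) t.
  by rewrite u2E.
rewrite !(lcs_constraintE xE) u2E; split=> //=.
  by rewrite [LHS]stateS stage_u2 stage_response closed_loop_dynamics.
rewrite lamS -(costate_step_feedback _ (state G u1 u2 (tnow k))).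
have := stage_response y k; rewrite -stage_u2 /= => <-.
by rewrite -stateS [P _ *m _ + _]addrC subrK.
Qed.

Lemma Omega1_reaction u1 u2 : reaction G u1 = [set u2] ->
  Omega1 G u1 <-> forall k, cvnneg (constraint G u1 u2 leader k).
Proof.
move=> reactE; have [u2_feas _] : reaction G u1 u2 by rewrite reactE.
split=> [[_ [w []]]|con_ge0]; last by split; [exists u2 | exists u2].
by rewrite reactE => /seteqP[/(_ u2 erefl) ->].
Qed.

Lemma lcs_feasible_reaction y : lcs_feasible G P y ->
  reaction G (lcs_u y) = [set lcs_response G P y] /\ Omega1 G (lcs_u y).
Proof.
move=> y_feas; have reactE := kkt_reaction (lcs_feasible_kkt y_feas).
split=> //; apply/(Omega1_reaction reactE) => k.
rewrite -lcs_constraintE; last exact: lcs_feasible_state.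
by have [_ _ /(_ k)[]] := y_feas.
Qed.

Lemma reaction_lcs_feasible u1 u2 : Omega1 G u1 -> reaction G u1 = [set u2] ->
  exists y : @lcs_point R K n m c,
    [/\ lcs_feasible G P y, lcs_u y = u1 & lcs_response G P y = u2].
Proof.
move=> + reactE => /(Omega1_reaction reactE) con_ge0.
have [mu [lam kkt_u2]] : exists mu lam, kkt u1 u2 mu lam.
  by apply: reaction_kkt; rewrite reactE.
exact: kkt_lcs_point kkt_u2 con_ge0.
Qed.

End Riccati.
End KKT.

Theorem theorem1 (R : realType) (K n : nat) (m c : player -> nat)
    (G : game R K n m c) (P : 'I_K.+1 -> 'M[R]_n) :
  (0 < K)%N -> regularity G -> riccati_condition G P ->
  GOLSE G = [set (lcs_u z, lcs_response G P z) | z in S_OCP_LCS G P].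
Proof.
move=> _ _ riccati.
have costE z : lcs_feasible G P z ->
    lcs_cost G P z = cost G (lcs_u z) (lcs_response G P z) leader.
  by move=> /lcs_feasible_state; exact: lcs_costE.
apply/seteqP; split=> [[u1 u2] [/= u1_Omega reactE u_min]|_ [z [z_feas z_min] <-]].
  have [z [z_feas zu zw]] := reaction_lcs_feasible riccati u1_Omega reactE.
  exists z; last by rewrite zu zw.
  split=> // y y_feas; rewrite !costE// zu zw.
  by have [reactyE y_Omega] := lcs_feasible_reaction riccati y_feas; exact: u_min.
have [reactE z_Omega] := lcs_feasible_reaction riccati z_feas.
split=> //= v1 v2 v1_Omega reactvE.
have [y [y_feas <- <-]] := reaction_lcs_feasible riccati v1_Omega reactvE.
by rewrite -!costE//; exact: z_min.
Qed.
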